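(* Let $n,m\ge 1$ be integers, let $P_0,P_1,\dots,P_m\in M_n(\mathbb{C})$ be unitary matrices and let $c_0,c_1,\dots,c_m\in\mathbb{R}$. Then the set of optimal solutions of the optimization problem $$\max_{X\in B(n)}\ \min_{1\le i\le m}\ \mathrm{Re}\big(\langle P_i-P_0,X\rangle\big)+c_i-c_0$$ contains a unitary matrix.
   Context: $M_n(\mathbb{C})$ is the space of $n\times n$ complex matrices, regarded as a real Hilbert space with inner product $\langle X_1,X_2\rangle=\mathrm{Re}(\mathrm{tr}(X_1^*X_2))$, where $X^*$ is the conjugate transpose (so the inner product is already real-valued and the outer $\mathrm{Re}$ is redundant). $B(n)=\{X\in M_n(\mathbb{C}): XX^*\preceq I_n\}$ is the closed unit ball for the spectral norm, where $A\preceq B$ means that $B-A$ is Hermitian positive semidefinite. The objective function being maximized is $X\mapsto\min_{1\le i\le m}\big(\mathrm{Re}(\langle P_i-P_0,X\rangle)+c_i-c_0\big)$, and its optimal solutions are its maximizers over $B(n)$. *)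

(* Defs.v *)
(* MathComp / MathComp-Analysis; the complex numbers are R[i], R : realType. *)
From HB Require Import structures.
From mathcomp Require Import all_boot all_order all_algebra.
From mathcomp Require Import sesquilinear spectral.
From mathcomp Require Import complex.
From mathcomp Require Import classical_sets reals.

Set Implicit Arguments.
Unset Strict Implicit.
Unset Printing Implicit Defensive.

Import Order.TTheory GRing.Theory Num.Theory.

Local Open Scope classical_set_scope.
Local Open Scope ring_scope.
Local Open Scope sesquilinear_scope.

Definition mxinner (R : realType) (n : nat) (X Y : 'M[R[i]]_n) : R :=
  complex.Re (\tr (X ^t* *m Y)).

(* In the order of R[i], 0 <= z means that z is real and nonnegative. *)
Definition psdmx (R : realType) (n : nat) (A : 'M[R[i]]_n) : Prop :=
  A \is hermsymmx /\
  forall v : 'cV[R[i]]_n, 0 <= (v ^t* *m A *m v) 0 0.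

Definition lemx (R : realType) (n : nat) (A B : 'M[R[i]]_n) : Prop :=
  psdmx (B - A).

Definition spectral_ball (R : realType) (n : nat) : set 'M[R[i]]_n :=
  [set X | lemx (X *m X ^t*) 1%:M].

(* Minimum of F 1, ..., F m, for m >= 1.  The default value F ord_max of the
   iterated minimum is F m, which is one of these terms as soon as m >= 1. *)
Definition min_1_to (R : realType) (m : nat) (F : 'I_m.+1 -> R) : R :=
  \big[Num.min/F ord_max]_(i < m.+1 | (0 < i)%N) F i.

Definition objective (R : realType) (n m : nat)
    (P : 'I_m.+1 -> 'M[R[i]]_n) (c : 'I_m.+1 -> R) (X : 'M[R[i]]_n) : R :=
  min_1_to (fun i : 'I_m.+1 => mxinner (P i - P ord0) X + c i - c ord0).

Definition maximizers (R : realType) (T : Type) (A : set T) (f : T -> R) :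
    set T :=
  [set x | A x /\ forall y, A y -> f y <= f x].

(* Main.v *)
(* Every X in the ball is dominated by a unitary matrix.  Write P_0^* X = A + iB
   with A and B hermitian.  Since X X^* <= 1 and X^* X <= 1, their average gives
   A^2 + B^2 <= 1, so U = iB - sqrt (1 - B^2) is unitary and
   D = P_0^* X - U = A + sqrt (1 - B^2) is positive semidefinite.  For a
   unitary V, Re tr (V D) <= tr D; with V = P_i^* P_0 this says that replacing X
   by P_0 U decreases no term of the minimum.  It remains to maximize over the
   unitary group, which is compact. *)
Require Import Defs.
From HB Require Import structures.
From mathcomp Require Import all_boot all_order all_algebra.
From mathcomp Require Import sesquilinear spectral.
From mathcomp Require Import complex.
From mathcomp Require Import classical_sets reals.
From mathcomp Require Import boolp topology normedtype derive.
From mathcomp Require Import ring.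

Set Implicit Arguments.
Unset Strict Implicit.
Unset Printing Implicit Defensive.

Import Order.TTheory GRing.Theory Num.Theory.
Import numFieldNormedType.Exports.

Local Open Scope classical_set_scope.
Local Open Scope ring_scope.
Local Open Scope sesquilinear_scope.
Local Notation "''[' u , v ]" := (dotmx u%R v%R) : ring_scope.
Local Notation "''[' u ]" := '[u, u]%R : ring_scope.

(** * Adjoints and hermitian matrices *)

Lemma trmxC_mul (C : numClosedFieldType) m n p (A : 'M[C]_(m, n))
    (B : 'M[C]_(n, p)) :
  (A *m B) ^t* = B ^t* *m A ^t*.
Proof. by rewrite trmx_mul map_mxM. Qed.

Lemma trmxC_diag (C : numClosedFieldType) n (d : 'rV[C]_n) :
  (diag_mx d) ^t* = diag_mx (map_mx Num.Def.conjC d).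
Proof. by rewrite tr_diag_mx map_diag_mx. Qed.

Lemma hermsymmxP (C : numClosedFieldType) n (A : 'M[C]_n) :
  reflect (A ^t* = A) (A \is hermsymmx).
Proof.
by apply: (iffP (is_hermitianmxP _ _ _)); rewrite expr0 scale1r => /esym.
Qed.

(** * Contractions, spectral decompositions and a unitary matrix below a contraction *)

Section Contractions.
Variables (C : numClosedFieldType) (n : nat).
Implicit Types (A B X U : 'M[C]_n) (u v w : 'rV[C]_n).

Lemma dotmx_adjoint A u v : '[u *m A, v] = '[u, v *m A ^t*].
Proof. by rewrite !dotmxE trmxC_mul trmxCK mulmxA. Qed.

Lemma dotmx_herm A u v : A \is hermsymmx -> '[u *m A, v] = '[u, v *m A].
Proof. by move/hermsymmxP => eA; rewrite dotmx_adjoint eA. Qed.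

Lemma dotmx_unitary U v : U \is unitarymx -> '[v *m U] = '[v].
Proof.
by move=> /mulmxtVK UK; rewrite dotmx_adjoint UK.
Qed.

Lemma dotmx_conj u v : '[u, v]^* = '[v, u].
Proof. by rewrite [RHS]hermC expr0 mul1r. Qed.

Lemma dotmx_ge0 v : 0 <= '[v].
Proof. exact: dnorm_ge0. Qed.

Lemma dotmxDl u v w : '[u + v, w] = '[u, w] + '[v, w].
Proof. by rewrite !dotmxE mulmxDl mxE. Qed.

Lemma dotmxZl a u v : '[a *: u, v] = a * '[u, v].
Proof. by rewrite linearZl_LR. Qed.

Lemma dotmx_normZ a u : '[a *: u] = `|a| ^+ 2 * '[u].
Proof. by rewrite dnormZ. Qed.

Lemma dotmx_normD u v : '[u + v] = '[u] + '[v] + ('[u, v] + '[v, u]).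
Proof. by rewrite dnormD /= dotmx_conj. Qed.

Lemma dotmx_normB u v : '[u - v] = '[u] + '[v] - ('[u, v] + '[v, u]).
Proof. by rewrite dnormB /= dotmx_conj. Qed.

(* With w = v X^*, the inequality is |v - w X|^2 >= 0. *)
Lemma contraction_adjoint X :
  (forall v, '[v *m X] <= '[v]) -> forall v, '[v *m X ^t*] <= '[v].
Proof.
move=> leX v; set w := v *m X ^t*.
have ew : '[v, w *m X] = '[w] by rewrite -[X in w *m X]trmxCK -dotmx_adjoint.
have := dotmx_ge0 (v - w *m X).
have ew' : '[w *m X, v] = '[w] by rewrite -dotmx_conj ew dotmx_conj.
rewrite dotmx_normB ew ew' => le0; have le1 := leX w.
rewrite -subr_ge0; apply: le_trans le0 _.
by rewrite -subr_ge0 (_ : _ - _ = '[w] - '[w *m X]) ?subr_ge0 //; ring.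
Qed.

Lemma eigenrowM A k : A \is normalmx ->
  row k (spectralmx A) *m A = spectral_diag A 0 k *: row k (spectralmx A).
Proof.
move/orthomx_spectralP => eA; rewrite [X in _ *m X]eA.
rewrite -!row_mul !mulmxA mulmxV ?spectral_unit // mul1mx.
by rewrite row_mul row_diag_mx -scalemxAl -rowE.
Qed.

Lemma dotmx_eigenrow A k : '[row k (spectralmx A)] = 1.
Proof.
by have /row_unitarymxP -> := spectral_unitarymx A; rewrite eqxx.
Qed.

(** Each row has norm 1, and the squared modulus of one entry is one term of that sum of nonnegative
    terms. *)
Lemma unitarymx_entry_le1 U i j : U \is unitarymx -> `|U i j| <= 1.
Proof.
move=> /row_unitarymxP /(_ i i); rewrite eqxx dotmxE mxE => e.
rewrite -(@expr_le1 _ 2) // -[X in _ <= X]e (bigD1 j) //= !mxE -normCK lerDl.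
by apply: sumr_ge0 => k _; rewrite !mxE -normCK exprn_ge0.
Qed.

(** In an eigenbasis of [A], the trace of [U A] is a combination of the eigenvalues weighted by the
    diagonal entries of a unitary matrix, and these have real part at most 1. *)
Lemma Re_trace_unitaryM U A : U \is unitarymx -> A \is normalmx ->
  (forall k, 0 <= spectral_diag A 0 k) -> 'Re (\tr (U *m A)) <= \tr A.
Proof.
move=> uU nA d0; have /orthomx_spectralP eA := nA.
have uQ := spectral_unitarymx A.
set Q := spectralmx A in uQ eA; set d := spectral_diag A in d0 eA.
have -> : \tr A = \sum_k d 0 k.
  rewrite eA mxtrace_mulC mulmxA mulmxV ?unitarymx_unit // mul1mx.
  exact: mxtrace_diag.
set V := Q *m U *m Q ^t*.
have uV : V \is unitarymx by rewrite !mul_unitarymx ?trmxC_unitary.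
have -> : \tr (U *m A) = \sum_k V k k * d 0 k.
  rewrite eA !mulmxA mxtrace_mulC !mulmxA invmx_unitary // -/V.
  by apply: eq_bigr => k _; rewrite mul_mx_diag mxE.
rewrite raddf_sum /=; apply: ler_sum => k _.
have rd : d 0 k \is Num.real by rewrite ger0_real.
rewrite ReMr //; apply: ler_piMl => //.
apply: le_trans (unitarymx_entry_le1 k k uV).
apply: le_trans (leif_normC_Re_Creal (V k k)).
by rewrite real_ler_norm ?Creal_Re.
Qed.

(* If [w] is a unit eigenvector of [A + S] with eigenvalue [d < 0], then
   [w A = d w - w S] has squared norm [d^2 - 2 d <w S, w> + |w S|^2], which
   exceeds [|w S|^2]. *)
Lemma hermitian_add_eigenval_ge0 A S : A \is hermsymmx -> S \is hermsymmx ->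
  (forall v, 0 <= '[v *m S, v]) -> (forall v, '[v *m A] <= '[v *m S]) ->
  forall k, 0 <= spectral_diag (A + S) 0 k.
Proof.
move=> hA hS S0 leAS k.
have hAS : A + S \is hermsymmx.
  move: hA hS => /hermsymmxP eA /hermsymmxP eS.
  by apply/hermsymmxP; rewrite linearD map_mxD /= eA eS.
have e1 := dotmx_eigenrow (A + S) k.
have := eigenrowM k (hermitian_normalmx hAS).
have : spectral_diag (A + S) 0 k \is Num.real.
  by have /mxOverP := hermitian_spectral_diag_real hAS; apply.
set w := row k _ in e1 *; set d := spectral_diag _ _ _ => rd ew.
rewrite real_leNgt ?real0 //; apply/negP => d0.
have {}ew : w *m A = d *: w - w *m S by rewrite -ew mulmxDr addrK.
have := leAS w; rewrite ew dotmx_normB dotmx_normZ e1 mulr1.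
have es : '[d *: w, w *m S] = d * '[w *m S, w].
  by rewrite dotmxZl -(dotmx_herm _ _ hS).
rewrite -['[w *m S, d *: w]]dotmx_conj es.
rewrite rmorphM /= (CrealP rd) (CrealP (ger0_real (S0 w))).
rewrite addrAC gerDr.
have lt0 : 0 < `|d| ^+ 2 - (d * '[w *m S, w] + d * '[w *m S, w]).
  rewrite ltr_wpDr ?exprn_gt0 ?normr_gt0 ?lt_eqF // oppr_ge0 -mulr2n.
  by rewrite mulrn_wle0 // mulr_le0_ge0 // ltW.
by rewrite (lt_geF lt0).
Qed.

(** All functions of [B] are formed in one eigenbasis of [B], so they commute and identities between
    them reduce to scalar identities on the eigenvalues. *)
Lemma unitary_below X : (forall v, '[v *m X] <= '[v]) ->
  exists U, [/\ U \is unitarymx, X - U \is hermsymmx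
    & forall k, 0 <= spectral_diag (X - U) 0 k].
Proof.
move=> leX; have leXa := contraction_adjoint leX.
have two0 : (2 : C) != 0 by rewrite pnatr_eq0.
(* The factor [- 'i / 2] is 1 / (2i), so that [A] and [B] are the hermitian real and imaginary parts
   of [X]. *)
pose A := 2^-1 *: (X + X ^t*); pose B := (- 'i / 2) *: (X - X ^t*).
have hA : A \is hermsymmx.
  apply/hermsymmxP; rewrite linearZ map_mxZ /= linearD map_mxD /= trmxCK.
  by rewrite fmorphV rmorph_nat addrC.
have hB : B \is hermsymmx.
  apply/hermsymmxP; rewrite linearZ map_mxZ /= linearB map_mxB /= trmxCK.
  rewrite rmorphM rmorphN /= conjCi opprK fmorphV rmorph_nat.
  by rewrite -[X ^t* - X]opprB scalerN /B mulNr scaleNr.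
have eX : X = A + 'i *: B.
  apply/matrixP => i j; rewrite !mxE; move: (_^*) => z.
  have := sqrCi C => ei.
  (* [field] treats ['i] as an indeterminate, so its square is isolated first and then replaced by
     -1. *)
  rewrite (_ : _ + _ = 2^-1 * (X i j + z - 'i ^+ 2 * (X i j - z))).
    by rewrite ei; field.
  by field.
(* Parallelogram law: the left side is the mean of |v X|^2 and |v X^*|^2. *)
have leAB v : '[v *m A] + '[v *m B] <= '[v].
  have nz : `|2^-1 : C| ^+ 2 = 4^-1 by rewrite normfV normr_nat exprVn -natrX.
  have ni : `|- 'i / 2 : C| ^+ 2 = 4^-1.
    by rewrite normrM normrN normCi mul1r nz.
  rewrite /A /B -!scalemxAr !dotmx_normZ nz ni mulmxDr mulmxBr.
  rewrite dotmx_normD dotmx_normB.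
  rewrite (_ : _ + _ = 2^-1 * ('[v *m X] + '[v *m X ^t*])); last by field.
  rewrite mulrC ler_pdivrMr ?ltr0n // mulr_natr mulr2n.
  exact: lerD (leX v) (leXa v).
set Q := spectralmx B; set b := spectral_diag B.
have uQ : Q \is unitarymx by exact: spectral_unitarymx.
have rb k : b 0 k \is Num.real.
  by have /mxOverP := hermitian_spectral_diag_real hB; apply.
(* Functional calculus of [B]: [conjQ d] has eigenvalues [d] on the eigenvectors of [B]. *)
pose conjQ (d : 'rV[C]_n) := Q ^t* *m diag_mx d *m Q.
have eB : B = conjQ b.
  rewrite /conjQ -invmx_unitary //.
  exact/orthomx_spectralP/hermitian_normalmx.
have conjQM d e : conjQ d *m conjQ e = conjQ (\row_k (d 0 k * e 0 k)).
  rewrite /conjQ !mulmxA mulmxtVK // -[_ *m diag_mx e]mulmxA mulmx_diag.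
  by congr (_ *m diag_mx _ *m _); apply/rowP => k; rewrite !mxE.
have conjQa d : (conjQ d) ^t* = conjQ (map_mx Num.Def.conjC d).
  by rewrite /conjQ !trmxC_mul trmxCK trmxC_diag mulmxA.
have conjQ1 : conjQ (const_mx 1) = 1%:M.
  rewrite /conjQ diag_const_mx mulmx1 -invmx_unitary //.
  by rewrite mulVmx ?unitarymx_unit.
(* Apply [leAB] to a unit eigenvector of [B] and drop the term in [A]. *)
have b1 k : 0 <= 1 - b 0 k ^+ 2.
  have := leAB (row k Q); rewrite (eigenrowM _ (hermitian_normalmx hB)).
  rewrite dotmx_normZ dotmx_eigenrow mulr1 real_normK // => le1.
  by rewrite subr_ge0; apply: le_trans le1; rewrite lerDr dotmx_ge0.
pose s : 'rV[C]_n := \row_k sqrtC (1 - b 0 k ^+ 2).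
have s0 k : 0 <= s 0 k by rewrite mxE sqrtC_ge0.
pose S := conjQ s.
have hS : S \is hermsymmx.
  apply/hermsymmxP; rewrite conjQa; congr conjQ; apply/rowP => k.
  by rewrite mxE (CrealP (ger0_real (s0 k))).
have eSB : S *m S + B *m B = 1%:M.
  rewrite eB !conjQM -conjQ1 /conjQ -mulmxDl -mulmxDr -raddfD /=.
  congr (_ *m diag_mx _ *m _); apply/rowP => k.
  by rewrite !mxE -!expr2 sqrtCK subrK.
exists ('i *: B - S); rewrite (_ : X - _ = A + S); last first.
  by rewrite {1}eX opprB addrACA subrr addr0.
split.
- apply/unitarymxP.
  (* The eigenvalues i b - s have squared modulus b^2 + s^2 = 1, which makes the matrix unitary. *)
  have -> : 'i *: B - S = conjQ (\row_k ('i * b 0 k - s 0 k)).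
    rewrite eB /S /conjQ scalemxAl scalemxAr -mulmxBl -mulmxBr.
    rewrite -linearZ -linearB; congr (_ *m diag_mx _ *m _).
    by apply/rowP => k; rewrite !mxE.
  rewrite conjQa conjQM -conjQ1; congr conjQ; apply/rowP => k.
  rewrite !mxE rmorphB rmorphM /= conjCi (CrealP (rb k)).
  have /ger0_real/CrealP := s0 k; rewrite mxE => ->.
  have := sqrtCK (1 - b 0 k ^+ 2); set t := sqrtC _ => et.
  have := sqrCi C => ei.
  rewrite (_ : _ * _ = t ^+ 2 - 'i ^+ 2 * b 0 k ^+ 2); last by ring.
  by rewrite et ei; ring.
- move: hA hS => /hermsymmxP eA /hermsymmxP eS.
  by apply/hermsymmxP; rewrite linearD map_mxD /= eA eS.
- apply: hermitian_add_eigenval_ge0 => // v.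
    set y := v *m Q ^t*.
    (* In the eigenbasis the form is the sum of s_k |y_k|^2. *)
    have -> : '[v *m S, v] = (y *m diag_mx s *m y ^t*) 0 0.
      by rewrite dotmxE trmxC_mul trmxCK /S /conjQ !mulmxA.
    rewrite mul_mx_diag mxE sumr_ge0 // => k _.
    move: y s0 => y /(_ k); rewrite [_ 0 k in X in _ -> X]mxE.
    move: (s 0 k) => t t0; rewrite !mxE mulrAC.
    by rewrite mulr_ge0 // mul_conjC_ge0.
  (* Since S^2 + B^2 = 1, |v S|^2 = |v|^2 - |v B|^2, and [leAB] bounds |v A|^2 by this. *)
  have : '[v *m S] + '[v *m B] = '[v].
    rewrite -(dotmx_herm _ _ hS) -(dotmx_herm _ _ hB) -dotmxDl.
    rewrite -[v *m S *m S]mulmxA -[v *m B *m B]mulmxA.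
    by rewrite -mulmxDr eSB mulmx1.
  by move=> eSv; rewrite -(lerD2r '[v *m B]) eSv.
Qed.

End Contractions.

(** * Compactness of the unitary group in real coordinates *)

Section UnitaryCompactness.
Variables (R : realType) (n : nat).

Local Notation index := ('I_n * 'I_n * bool)%type.
Local Notation coords := 'rV[R]_#|{: index}|.

(* Real coordinates, because the compactness theorem for row vectors is used
   over R only. *)
Definition mx_of_coords (v : coords) : 'M[R[i]]_n :=
  \matrix_(i, j)
    (v 0 (enum_rank (i, j, true)) +i* v 0 (enum_rank (i, j, false)))%C.

Definition coords_of_mx (A : 'M[R[i]]_n) : coords :=
  \row_k let: (i, j, b) := enum_val k in
    if b then complex.Re (A i j) else complex.Im (A i j).

Lemma coords_of_mxK : cancel coords_of_mx mx_of_coords.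
Proof.
by move=> A; apply/matrixP => i j; rewrite !mxE !enum_rankK; case: (A i j).
Qed.

(* R[i] is not topologized here: continuity is that of both parts. *)
Definition ccontinuous (T : topologicalType) (f : T -> R[i]) :=
  continuous (fun x => complex.Re (f x)) /\
  continuous (fun x => complex.Im (f x)).

Lemma ccontinuous_cst (T : topologicalType) (z : R[i]) :
  ccontinuous (fun _ : T => z).
Proof. by split=> x; exact: cvg_cst. Qed.

Lemma ccontinuousD (T : topologicalType) (f g : T -> R[i]) :
  ccontinuous f -> ccontinuous g -> ccontinuous (fun x => f x + g x).
Proof.
move=> [fr fi] [gr gi]; split=> x.
- under eq_fun do rewrite raddfD /=.
  exact: cvgD (fr x) (gr x).
- under eq_fun do rewrite raddfD /=.
  exact: cvgD (fi x) (gi x).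
Qed.

Lemma ccontinuousM (T : topologicalType) (f g : T -> R[i]) :
  ccontinuous f -> ccontinuous g -> ccontinuous (fun x => f x * g x).
Proof.
move=> [fr fi] [gr gi]; split=> x.
- have -> : (fun x => complex.Re (f x * g x)) = (fun x =>
    complex.Re (f x) * complex.Re (g x) - complex.Im (f x) * complex.Im (g x)).
    by apply/funext => y; case: (f y) (g y) => [a b] [c d].
  exact: cvgB (cvgM (fr x) (gr x)) (cvgM (fi x) (gi x)).
- have -> : (fun x => complex.Im (f x * g x)) = (fun x =>
    complex.Re (f x) * complex.Im (g x) + complex.Im (f x) * complex.Re (g x)).
    by apply/funext => y; case: (f y) (g y) => [a b] [c d].
  exact: cvgD (cvgM (fr x) (gi x)) (cvgM (fi x) (gr x)).
Qed.

Lemma ccontinuous_conj (T : topologicalType) (f : T -> R[i]) :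
  ccontinuous f -> ccontinuous (fun x => (f x)^*).
Proof.
move=> [fr fi]; split=> x.
- have -> : (fun x => complex.Re (f x)^*) = (fun x => complex.Re (f x)).
    by apply/funext => y; case: (f y).
  exact: fr.
- have -> : (fun x => complex.Im (f x)^*) = (fun x => - complex.Im (f x)).
    by apply/funext => y; case: (f y).
  exact: cvgN (fi x).
Qed.

Lemma ccontinuous_sum (T : topologicalType) (I : finType) (f : I -> T -> R[i]) :
  (forall i, ccontinuous (f i)) -> ccontinuous (fun x => \sum_i f i x).
Proof.
move=> cf; elim: (index_enum I) => [|i s IHs].
  by under eq_fun do rewrite big_nil; exact: ccontinuous_cst.
by under eq_fun do rewrite big_cons; exact: ccontinuousD.
Qed.

Lemma ccontinuous_coords i j : ccontinuous (fun v => mx_of_coords v i j).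
Proof.
by split=> v; under eq_fun do rewrite mxE /=; exact: coord_continuous.
Qed.

(** The set is closed, being cut out by the entrywise equations of U U^* = 1, and it lies in the
    compact cube [-1, 1]^N because entries have modulus at most 1. *)
Lemma unitary_coords_compact :
  compact [set v : coords | mx_of_coords v \is unitarymx].
Proof.
apply: (@subclosed_compact _ _
  [set v : coords | forall k, `[-1, 1]%classic (v 0 k)]).
- pose F i j v := (mx_of_coords v *m (mx_of_coords v) ^t*) i j.
  have cF i j : ccontinuous (F i j).
    have -> : F i j = fun v =>
        \sum_k mx_of_coords v i k * (mx_of_coords v j k)^*.
      apply/funext => v; rewrite /F mxE; apply: eq_bigr => k _.
      by congr (_ * _); rewrite mxE mxE.
    apply: ccontinuous_sum => k.
    apply: ccontinuousM; first exact: ccontinuous_coords.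
    exact/ccontinuous_conj/ccontinuous_coords.
  have -> : [set v : coords | mx_of_coords v \is unitarymx] =
      \bigcap_(p in [set: 'I_n * 'I_n])
        ([set v | complex.Re (F p.1 p.2 v) =
                  complex.Re (1%:M p.1 p.2 : R[i])] `&`
         [set v | complex.Im (F p.1 p.2 v) =
                  complex.Im (1%:M p.1 p.2 : R[i])]).
    apply/seteqP; split => v /=.
      by move=> /unitarymxP uv [i j] _; split; rewrite /= /F uv.
    move=> eF; apply/unitarymxP/matrixP => i j.
    by have /= [] := eF (i, j) I; rewrite /F; case: (_ i j) (1%:M i j)
      => [a b] [c d] /= -> ->.
  apply: closed_bigI => -[i j] _; have [cr ci] := cF i j.
  have closed_fiber (g : coords -> R) r :
      continuous g -> closed [set v | g v = r].
    move=> cg; apply: (@preimage_closed _ _ g [set r]); last exact: closed_eq.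
    by move=> x _; exact: cg.
  by apply: closedI; exact: closed_fiber.
- apply: (@rV_compact R _ (fun=> `[-1, 1]%classic)) => k.
  exact: segment_compact.
- move=> v /= uv k; rewrite -(enum_valK k) in_itv /= -ler_norml.
  case: (enum_val k) => -[i j] b.
  have := unitarymx_entry_le1 i j uv => le1.
  rewrite -lecR; apply: le_trans le1; case: b.
    by apply: le_trans (normc_ge_Re _); rewrite mxE.
  (* The imaginary part of z is, up to sign, the real part of z i, and z i has the same modulus as
     z. *)
  have := normc_ge_Re (mx_of_coords v i j * 'i%C).
  by rewrite ReiNIm normrN normrM [X in _ * X]normCi mulr1 mxE.
Qed.

(** Extreme value theorem on the compact set of coordinates, which is nonempty because it contains
    those of the identity matrix. *)
Lemma unitary_max (f : 'M[R[i]]_n -> R) :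
  continuous (f \o mx_of_coords) ->
  exists2 U, U \is unitarymx & forall V, V \is unitarymx -> f V <= f U.
Proof.
move=> cf.
pose S := [set v : coords | mx_of_coords v \is unitarymx].
have S0 : S !=set0.
  exists (coords_of_mx 1%:M); rewrite /S /= coords_of_mxK.
  by apply/unitarymxP; rewrite mul1mx trmx1 map_mx1.
have [v Sv maxv] := compact_EVT_max S0 unitary_coords_compact
  (continuous_subspaceT cf).
exists (mx_of_coords v) => [|V uV]; first by rewrite inE in Sv.
have := maxv (coords_of_mx V); rewrite /= coords_of_mxK; apply.
by rewrite inE /S /= coords_of_mxK.
Qed.

End UnitaryCompactness.

(** * The objective function and its unitary maximizers *)

Lemma objective_continuous (R : realType) (n m : nat)
    (P : 'I_m.+1 -> 'M[R[i]]_n) (c : 'I_m.+1 -> R) :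
  continuous (objective P c \o @mx_of_coords R n).
Proof.
have cF i : continuous (fun v =>
    mxinner (P i - P ord0) (mx_of_coords v) + c i - c ord0).
  have [cr _] : ccontinuous (fun v =>
      \tr ((P i - P ord0) ^t* *m @mx_of_coords R n v)).
    apply: ccontinuous_sum => k; under eq_fun do rewrite mxE.
    apply: ccontinuous_sum => l; apply: ccontinuousM.
      exact: ccontinuous_cst.
    exact: ccontinuous_coords.
  by move=> w; exact: cvgB (cvgD (cr w) (cvg_cst _)) (cvg_cst _).
rewrite /comp /objective /min_1_to.
(* The empty minimum is the default term [F ord_max], itself one of the continuous functions of
   [cF]. *)
elim: (index_enum _) => [|i s IHs].
  by under eq_fun do rewrite big_nil; exact: cF.
under eq_fun do rewrite big_cons; case: (0 < i)%N => // v.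
exact: (@continuous_min R _ (fun v => _) (fun v => _) v (cF i v) (IHs v)).
Qed.

Lemma unitary_contraction (R : realType) n (X : 'M[R[i]]_n) :
  X \is unitarymx -> spectral_ball X.
Proof.
move=> /unitarymxP eX; rewrite /spectral_ball /lemx /= eX subrr; split.
  by apply/hermsymmxP; rewrite trmx0 map_mx0.
by move=> v; rewrite mulmx0 mul0mx mxE.
Qed.

Lemma objective_unitary_ge (R : realType) (n m : nat)
    (P : 'I_m.+1 -> 'M[R[i]]_n) (c : 'I_m.+1 -> R) (X : 'M[R[i]]_n) :
  (forall i, P i \is unitarymx) -> spectral_ball X ->
  exists2 U, U \is unitarymx & objective P c X <= objective P c U.
Proof.
move=> uP [_ ballX]; set P0 := P ord0.
have uP0 : P0 \is unitarymx by exact: uP.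
have leX v : '[v *m (P0 ^t* *m X)] <= '[v].
  have := ballX ((v *m P0 ^t*) ^t*).
  rewrite trmxCK mulmxBr mulmxBl mulmx1 mxE [X in _ + X]mxE subr_ge0.
  set u := v *m _; move=> le1; rewrite mulmxA -/u.
  rewrite -(@dotmx_unitary _ _ (P0 ^t*) v) ?trmxC_unitary //.
  by move: le1; rewrite !mulmxA -mulmxA -trmxC_mul -!dotmxE.
have [U0 [uU0 hD D0]] := unitary_below leX.
exists (P0 *m U0); first exact: mul_unitarymx.
have le_inner i : mxinner (P i - P0) X <= mxinner (P i - P0) (P0 *m U0).
  set D := P0 ^t* *m X - U0 in hD D0.
  have uV : (P i) ^t* *m P0 \is unitarymx.
    by rewrite mul_unitarymx ?trmxC_unitary.
  have := Re_trace_unitaryM uV (hermitian_normalmx hD) D0.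
  (* An inequality in R[i] says that imaginary parts agree and real parts are ordered; only the
     latter is kept. *)
  rewrite -complexRe lecE /= => /andP[_ leD].
  (* The gain from X to P_0 U_0 is tr D - Re tr (P_i^* P_0 D), since P_0^* P_0 = 1. *)
  have -> : X = P0 *m U0 + P0 *m D.
    by rewrite -mulmxDr addrC subrK mulmxA (unitarymxP uP0) mul1mx.
  rewrite /mxinner mulmxDr raddfD [complex.Re _]raddfD /= gerDl.
  rewrite linearB map_mxB /= mulmxBl !mulmxA.
  rewrite -(invmx_unitary uP0) mulVmx ?unitarymx_unit // mul1mx.
  by rewrite raddfB [complex.Re _]raddfB /= subr_le0.
rewrite /objective /min_1_to.
have le_term i : mxinner (P i - P0) X + c i - c ord0 <=
    mxinner (P i - P0) (P0 *m U0) + c i - c ord0 by rewrite !lerD2r.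
(* Minimum is monotone in both arguments, and [le_term] also covers the default term. *)
apply: (big_ind2 (fun a b : R => a <= b)) => // a b a' b' leab leab'.
by rewrite le_min !ge_min leab leab' orbT.
Qed.

Theorem theorem1 (R : realType) (n m : nat) (hn : (0 < n)%N) (hm : (0 < m)%N)
    (P : 'I_m.+1 -> 'M[R[i]]_n) (c : 'I_m.+1 -> R)
    (hP : forall i : 'I_m.+1, P i \is unitarymx) :
  exists U : 'M[R[i]]_n,
    U \is unitarymx /\ maximizers (@spectral_ball R n) (objective P c) U.
Proof.
have [U uU maxU] := unitary_max (@objective_continuous R n m P c).
exists U; split => //; split; first exact: unitary_contraction.
(* The dominating [V] depends on [X], but [U] is at least as good as every unitary matrix. *)
move=> X ballX; have [V uV leV] := objective_unitary_ge c hP ballX.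
exact: le_trans leV (maxU V uV).
Qed.
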